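(* Let $\lambda$ be a partition of $n$, let $S$ be a filling of $\lambda$ with nonnegative integers, let $T\in\mathrm{SYT}(\lambda)$, and let $P$ be a $T$-snaking. Then the coefficient of the monomial $\mathbf{x}_P^S$ in $F_T^S$ is $$\pm\,|H(S)|\cdot\sum_{\tau\in A(\pi\cdot S)}(-1)^\tau,$$ where $\pi$ is the row permutation (of boxes) that returns each entry of $P$ to its original column in $T$.
   Context: Young diagrams are in French notation (the first, largest part is the bottom row). $\mathrm{SYT}(\lambda)$ is the set of standard Young tableaux of shape $\lambda$ (entries $1,\dots,n$, increasing along rows and up columns). $\mathfrak S_n$ acts on $\mathbb{C}[x_1,\dots,x_n]$ by $\sigma x_i=x_{\sigma(i)}$. $\mathcal R(T),\mathcal C(T)\subseteq\mathfrak S_n$ are the subgroups preserving the set of entries of each row, respectively column, of $T$, and $\varepsilon_T=\sum_{\tau\in\mathcal C(T)}\sum_{\sigma\in\mathcal R(T)}(-1)^\tau\,\tau\sigma$. For a filling $S$ by nonnegative integers and a bijective filling $P$ of $\lambda$ by $1,\dots,n$, $\mathbf{x}_P^S=\prod_{b\in\lambda}x_{P(b)}^{S(b)}$ (over boxes $b$). $F_T^S=\varepsilon_T\mathbf{x}_T^S$. A $T$-snaking is a bijective filling $P$ of $\lambda$ by $1,\dots,n$ such that whenever $i\ne j$ occur in the same column of $T$, they occur in different rows of $P$. Box action: label the boxes of $\lambda$ canonically by $1,\dots,n$, going up each column from bottom to top, columns from left to right. $\mathfrak S_n$ acts on fillings by permuting boxes: $(\pi\cdot Z)(b)=Z(\pi^{-1}(b))$.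 Row (resp. column) permutations of boxes are the $\pi\in\mathfrak S_n$ preserving the set of canonical labels in each row (resp. column) of $\lambda$. The permutation $\pi$ in the claim is the unique row permutation of boxes such that, for every $j$, the $j$-th column of $\pi\cdot P$ has the same set of entries as the $j$-th column of $T$. $H(S)$ is the group of row permutations $\rho$ of boxes with $\rho\cdot S=S$. For a filling $Z$, $A(Z)$ is the set of column permutations $\tau$ of boxes such that $\tau\cdot Z$ has the same multiset of entries as $Z$ in each row (equivalently $\tau\cdot Z=\sigma\cdot Z$ for some row permutation $\sigma$). $(-1)^\tau$ is the sign of $\tau$. *)

(* Defs.v *)
(* Mathematical Components, with mathcomp-multinomials for polynomials and
   mathcomp-real-closed for the complex numbers R[i]. *)
From HB Require Import structures.
From mathcomp Require Import all_boot all_order all_algebra all_fingroup.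
From mathcomp Require Import mpoly complex.
From mathcomp Require Import reals.

Set Implicit Arguments.
Unset Strict Implicit.
Unset Printing Implicit Defensive.

Import GRing.Theory.

Local Open Scope ring_scope.

(* Entries, box labels and variable indices 1, ..., n become 0, ..., n-1, the
   elements of 'I_n; rows and columns are also numbered from 0, row 0 being the
   bottom (largest) one. A box of the diagram of la is identified with its
   canonical label, an element of 'I_n. Hence a filling with values in V is a
   function 'I_n -> V, a bijective filling by 1, ..., n is a permutation of
   'I_n, and box permutations and permutations of the entries are both elements
   of 'S_n. *)

Definition is_partition (n : nat) (la : seq nat) : Prop :=
  [/\ sorted geq la, 0%N \notin la & sumn la = n].

(* count (fun p => c < p) la is the height of column c. *)
Definition cells (la : seq nat) : seq (nat * nat) :=
  [seq (r, c) | c <- iota 0 (head 0%N la),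
                r <- iota 0 (count (fun p => (c < p)%N) la)].

Definition box_row (la : seq nat) (b : nat) : nat := (nth (0, 0) (cells la) b).1.
Definition box_col (la : seq nat) (b : nat) : nat := (nth (0, 0) (cells la) b).2.

Section Tableaux.
Variables (n : nat) (la : seq nat).

Definition row_boxes (r : nat) : {set 'I_n} := [set b : 'I_n | box_row la b == r].
Definition col_boxes (c : nat) : {set 'I_n} := [set b : 'I_n | box_col la b == c].

Definition is_SYT (T : 'S_n) : Prop :=
  (forall b b' : 'I_n, box_row la b = box_row la b' ->
     (box_col la b < box_col la b')%N -> (T b < T b')%N) /\
  (forall b b' : 'I_n, box_col la b = box_col la b' ->
     (box_row la b < box_row la b')%N -> (T b < T b')%N).

(* A diagram with n boxes has at most n rows and n columns, so it is enough to
   index the family X by 'I_n. *)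
Definition preserving (X : nat -> {set 'I_n}) : {set 'S_n} :=
  [set s : 'S_n | [forall k : 'I_n, s @: X k == X k]].

Definition row_perms : {set 'S_n} := preserving row_boxes.
Definition col_perms : {set 'S_n} := preserving col_boxes.

Definition row_group (T : 'S_n) : {set 'S_n} :=
  preserving (fun r => T @: row_boxes r).
Definition col_group (T : 'S_n) : {set 'S_n} :=
  preserving (fun c => T @: col_boxes c).

(* T^-1 i is the box of T that contains the entry i. *)
Definition is_snaking (T P : 'S_n) : Prop :=
  forall i j : 'I_n, i != j ->
    box_col la ((T^-1)%g i) = box_col la ((T^-1)%g j) ->
    box_row la ((P^-1)%g i) <> box_row la ((P^-1)%g j).

Definition box_act (V : Type) (s : 'S_n) (Z : 'I_n -> V) : 'I_n -> V :=
  fun b => Z ((s^-1)%g b).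

Definition returns_columns (T P s : 'S_n) : Prop :=
  s \in row_perms /\
  forall c : nat, box_act s P @: col_boxes c = T @: col_boxes c.

Definition H (S : 'I_n -> nat) : {set 'S_n} :=
  [set rho in row_perms | [forall b, box_act rho S b == S b]].

Definition row_entries (Z : 'I_n -> nat) (r : nat) : seq nat :=
  [seq Z b | b <- enum (row_boxes r)].

Definition A (Z : 'I_n -> nat) : {set 'S_n} :=
  [set tau in col_perms |
    [forall r : 'I_n, perm_eq (row_entries (box_act tau Z) r)
                              (row_entries Z r)]].

(* The exponent vector of x_P^S. *)
Definition xmon (P : 'S_n) (S : 'I_n -> nat) : 'X_{1..n} :=
  (\sum_(b : 'I_n) U_(P b) *+ S b)%MM.

(* msym s substitutes 'X_(s i) for 'X_i, which is the action of 'S_n on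
   polynomials. The product tau sigma is applied as "first sigma, then tau":
   in 'S_n it is written sigma * tau, as composition there is left to right. *)
Definition young_sym (K : comNzRingType) (T : 'S_n) (f : {mpoly K[n]}) :
    {mpoly K[n]} :=
  \sum_(tau in col_group T) \sum_(sigma in row_group T)
    (-1) ^+ tau *: msym tau (msym sigma f).

Definition F (K : comNzRingType) (T : 'S_n) (S : 'I_n -> nat) : {mpoly K[n]} :=
  young_sym T 'X_[xmon T S].

End Tableaux.

(* Main.v *)
Require Import Defs.
From HB Require Import structures.
From mathcomp Require Import all_boot all_order all_algebra all_fingroup.
From mathcomp Require Import mpoly complex.
From mathcomp Require Import reals.

Set Implicit Arguments.
Unset Strict Implicit.
Unset Printing Implicit Defensive.

Import GRing.Theory.

Local Open Scope ring_scope.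

(** Box permutations turn everything into a question about two subgroups of
    ['S_n]: the row permutations and the column permutations, which intersect
    trivially.

    The geometric input is that the box permutation [T * P^-1] (from a box to
    the box where [P] has the entry that [T] has there) factors as a column
    permutation [psi] followed by the inverse of a row permutation [pi]. The
    entries of a column of [T] lie in distinct rows of [P], so the bottom [k]
    rows of [P] receive at most [min k h] entries of a column of height [h].
    The sum of these bounds over the columns is the number of boxes in the
    bottom [k] rows, so all the bounds are attained; with [k = h], the entries
    of each column of [T] occupy in [P] exactly the rows that meet this column
    ([snaking_row_lt_height]). They can hence be slid along the rows back to
    their column, which defines [pi] ([snaking_factor], [snaking_returns]).

    Conjugating by [T], the polynomial [F] becomes the signed sum of the
    monomials [xmon (s * tau * T) S] over row permutations [s] and column
    permutations [tau] ([young_sym_xmon]). By the factorization, such a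
    monomial is [xmon P S] exactly when [s S = t (pi S)] for the column
    permutation [t = (tau * psi)^-1]. Given a column permutation [t], the row
    permutations [s] with [s S = t (pi S)] exist only for [t] in [A (pi S)],
    and then form a coset of [H S] ([card_row_perms_act]). The substitution [t
    = (tau * psi)^-1] contributes the global sign, which is the sign of [psi]
    ([coef_young_sym]). *)

(** * Boxes of a Young diagram *)

(** The height of column [c] of the diagram of [la]. *)
Definition col_height (la : seq nat) (c : nat) : nat :=
  count (fun p => (c < p)%N) la.

(** The column heights of a partition form its conjugate partition, of the same
    size. *)
Lemma sum_col_height (la : seq nat) (m : nat) :
  all (fun p => (p <= m)%N) la ->
  (\sum_(c < m) col_height la c)%N = sumn la.
Proof.
elim: la => [_|p la IH /= /andP[le_pm /IH <-]]; first by rewrite big1.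
rewrite big_split /=; congr addn.
rewrite -[RHS]card_ord -sum1_card (big_ord_widen m (fun=> 1%N)) //.
rewrite [RHS]big_mkcond /=.
by apply: eq_bigr => i _; case: ltnP.
Qed.

Section Partition.
Variables (n : nat) (la : seq nat).
Hypothesis la_part : is_partition n la.

Lemma part_le_head : all (fun p => (p <= head 0 la)%N) la.
Proof.
case: la_part => + _ _; case: la => //= p s; rewrite leqnn /=.
by apply: order_path_min => y x z le_yx /leq_trans; apply.
Qed.

Lemma size_part : (size la <= n)%N.
Proof.
case: la_part => _ + <-; elim: la => //= p s IH.
rewrite inE negb_or => /andP[p_neq0 /IH le_s].
by rewrite -add1n leq_add // lt0n eq_sym.
Qed.

Lemma head_part : (head 0 la <= n)%N.
Proof. by case: la_part => _ _ <-; case: la => //= p s; rewrite leq_addr. Qed.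

Lemma mem_cells (r c : nat) : ((r, c) \in cells la) = (r < col_height la c)%N.
Proof.
apply/allpairsPdep/idP => [[c' [r' [_ + [-> ->]]]]|lt_rc].
  by rewrite mem_iota.
exists c, r; rewrite !mem_iota /=; split=> //.
have : has (fun p => (c < p)%N) la by rewrite has_count (leq_ltn_trans _ lt_rc).
by case/hasP => p p_la lt_cp; apply: leq_trans lt_cp (allP part_le_head p p_la).
Qed.

Lemma size_cells : size (cells la) = n.
Proof.
case: (la_part) => _ _ <-; rewrite -(sum_col_height part_le_head).
rewrite size_allpairs_dep sumnE big_map -[head _ _ in LHS]subn0.
rewrite -/(index_iota _ _) big_mkord.
by apply: eq_bigr => c _; rewrite size_iota.
Qed.

Lemma uniq_cells : uniq (cells la).
Proof.
apply: allpairs_uniq_dep; first exact: iota_uniq.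
  by move=> c _; apply: iota_uniq.
by move=> [c r] [c' r'] _ _ /= [-> ->].
Qed.

Lemma box_cell (b : 'I_n) :
  (box_row la b, box_col la b) = nth (0, 0)%N (cells la) b.
Proof. by rewrite /box_row /box_col; case: nth. Qed.

Lemma box_inj (b b' : 'I_n) :
  box_row la b = box_row la b' -> box_col la b = box_col la b' -> b = b'.
Proof.
move=> eq_r eq_c; have := box_cell b; rewrite eq_r eq_c box_cell => /eqP.
by rewrite nth_uniq ?size_cells ?uniq_cells // => /eqP/val_inj.
Qed.

Lemma box_row_lt_height (b : 'I_n) :
  (box_row la b < col_height la (box_col la b))%N.
Proof. by rewrite -mem_cells box_cell mem_nth // size_cells. Qed.

Lemma box_exists (r c : nat) : (r < col_height la c)%N ->
  exists b : 'I_n, box_row la b = r /\ box_col la b = c.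
Proof.
rewrite -mem_cells; case/(nthP (0, 0)%N) => i; rewrite size_cells => lt_in def_i.
by exists (Ordinal lt_in); rewrite /box_row /box_col /= def_i.
Qed.

Lemma box_row_lt (b : 'I_n) : (box_row la b < n)%N.
Proof.
apply: leq_trans (box_row_lt_height b) _.
exact: leq_trans (count_size _ _) size_part.
Qed.

Lemma box_col_lt (b : 'I_n) : (box_col la b < n)%N.
Proof.
apply: leq_trans head_part.
have := mem_nth (0, 0)%N (leq_trans (ltn_ord b) (eq_leq (esym size_cells))).
by case/allpairsPdep => c [r [+ _ def_b]]; rewrite /box_col def_b mem_iota.
Qed.

(** * Row and column permutations *)

(** [preserving] only tests the classes with an index below [n]; with [f] bounded
    by [n] these are all the nonempty ones. *)
Lemma preservingP (f : 'I_n -> nat) (s : 'S_n) : (forall b, (f b < n)%N) ->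
  reflect (forall b, f (s b) = f b)
          (s \in preserving (fun k => [set b | f b == k])).
Proof.
move=> lt_fn; rewrite inE; apply: (iffP forallP) => [s_f b|s_f k].
  have /eqP/setP/(_ (s b)) := s_f (Ordinal (lt_fn b)).
  by rewrite mem_imset ?inE /= ?eqxx; [move/esym/eqP | apply: perm_inj].
apply/eqP/setP => b; rewrite -[b](permKV s) mem_imset ?inE ?s_f //.
exact: perm_inj.
Qed.

Lemma row_permsP (s : 'S_n) :
  reflect (forall b, box_row la (s b) = box_row la b) (s \in row_perms n la).
Proof. exact: (preservingP s box_row_lt). Qed.

Lemma col_permsP (s : 'S_n) :
  reflect (forall b, box_col la (s b) = box_col la b) (s \in col_perms n la).
Proof. exact: (preservingP s box_col_lt). Qed.

Lemma row_permsM (s t : 'S_n) :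
  s \in row_perms n la -> t \in row_perms n la -> (s * t)%g \in row_perms n la.
Proof.
move=> /row_permsP s_r /row_permsP t_r; apply/row_permsP => b.
by rewrite permM t_r.
Qed.

Lemma row_permsV (s : 'S_n) :
  ((s^-1)%g \in row_perms n la) = (s \in row_perms n la).
Proof.
apply/row_permsP/row_permsP => s_r b; first by rewrite -{2}[b](permK s) s_r.
by rewrite -{2}[b](permKV s) s_r.
Qed.

Lemma col_permsM (s t : 'S_n) :
  s \in col_perms n la -> t \in col_perms n la -> (s * t)%g \in col_perms n la.
Proof.
move=> /col_permsP s_c /col_permsP t_c; apply/col_permsP => b.
by rewrite permM t_c.
Qed.

Lemma col_permsV (s : 'S_n) :
  ((s^-1)%g \in col_perms n la) = (s \in col_perms n la).
Proof.
apply/col_permsP/col_permsP => s_c b; first by rewrite -{2}[b](permK s) s_c.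
by rewrite -{2}[b](permKV s) s_c.
Qed.

Lemma row_col_perm (s : 'S_n) :
  s \in row_perms n la -> s \in col_perms n la -> s = 1%g.
Proof.
move=> /row_permsP s_r /col_permsP s_c; apply/permP => b; rewrite perm1.
exact: box_inj.
Qed.

(** * The row permutation attached to a snaking *)

(** If [f] permutes the boxes and sends distinct boxes of a column to distinct
    rows, then [f] sends at most as many boxes of column [c] into the bottom [k]
    rows as there are boxes of column [c] in these rows; summing over [c] gives
    the number of boxes in the bottom [k] rows on both sides, so equality holds
    in every column.  For [k] the height of column [c] this says that [f] sends
    column [c] into the rows meeting it. *)
Lemma snaking_row_lt_height (f : 'S_n) :
  (forall b b' : 'I_n, b != b' -> box_col la b = box_col la b' ->
     box_row la (f b) <> box_row la (f b')) ->
  forall b, (box_row la (f b) < col_height la (box_col la b))%N.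
Proof.
move=> f_snake b0; set k := col_height la (box_col la b0).
pose lowf (c : nat) :=
  [set b : 'I_n | (box_row la (f b) < k)%N & box_col la b == c].
pose low (c : nat) := [set b : 'I_n | (box_row la b < k)%N & box_col la b == c].
have le_low c : (#|lowf c| <= #|low c|)%N.
  have [le_kc|lt_ck] := leqP k (col_height la c); last first.
    apply/subset_leq_card/subsetP => b; rewrite !inE => /andP[_ /eqP def_c].
    by rewrite def_c eqxx andbT (leq_trans (box_row_lt_height b)) // def_c ltnW.
  (* Slide the images of the boxes of column c horizontally into column c. *)
  pose g b := odflt b [pick b' : 'I_n | (box_row la b' == box_row la (f b))
                                        && (box_col la b' == c)].
  have gP b : b \in lowf c ->
      box_row la (g b) = box_row la (f b) /\ box_col la (g b) = c.
    rewrite inE /g => /andP[lt_k _].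
    case: pickP => [b' /andP[/eqP ? /eqP ?] // | no].
    have [b' [r_b' c_b']] := box_exists (leq_trans lt_k le_kc).
    by have:= no b'; rewrite r_b' c_b' !eqxx.
  have g_inj : {in lowf c &, injective g}.
    move=> b b' b_l b'_l eq_g; apply/eqP/negPn/negP => neq_bb'.
    have [+ _] := gP b b_l; rewrite eq_g; have [-> _] := gP b' b'_l.
    move/esym; apply: f_snake neq_bb' _; move: b_l b'_l; rewrite !inE.
    by move=> /andP[_ /eqP ->] /andP[_ /eqP ->].
  rewrite -(card_in_imset g_inj) subset_leq_card //.
  apply/subsetP => _ /imsetP[b b_l ->]; rewrite inE.
  by have [-> ->] := gP b b_l; move: b_l; rewrite eqxx inE => /andP[-> _].
have sum_cols (p : pred 'I_n) :
    (\sum_(c < n) #|[set b | p b & box_col la b == c]|)%N = #|[set b | p b]|.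
  rewrite -[RHS]sum1_card.
  rewrite [RHS](partition_big (fun b => Ordinal (box_col_lt b)) xpredT) //=.
  apply: eq_bigr => c _; rewrite -sum1_card; apply: eq_bigl => b.
  by rewrite !inE -val_eqE.
have eq_sum : (\sum_(c < n) #|lowf c| = \sum_(c < n) #|low c|)%N.
  rewrite !sum_cols -(card_imset _ (@perm_inj _ f)); apply: eq_card => b.
  by rewrite -[b](permKV f) mem_imset ?inE //; apply: perm_inj.
have [_] := leqif_sum (fun (c : 'I_n) (_ : true) => leqif_eq (le_low c)).
rewrite eq_sum eqxx => /esym/forallP/(_ (Ordinal (box_col_lt b0)))/eqP /= eq_b0.
have low_col :
    low (box_col la b0) = [set b : 'I_n | box_col la b == box_col la b0].
  apply/setP => b; rewrite !inE; case: eqP => [def_c|]; last by rewrite andbF.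
  by rewrite andbT /k -def_c box_row_lt_height.
have : lowf (box_col la b0) = [set b : 'I_n | box_col la b == box_col la b0].
  apply/eqP; rewrite eqEcard -low_col eq_b0 leqnn andbT low_col.
  by apply/subsetP => b; rewrite !inE => /andP[].
by move/setP/(_ b0); rewrite !inE eqxx andbT.
Qed.

(** A box permutation that sends distinct boxes of a column to distinct rows is
    the product of a column permutation and a row permutation. *)
Lemma snaking_factor (f : 'S_n) :
  (forall b b' : 'I_n, b != b' -> box_col la b = box_col la b' ->
     box_row la (f b) <> box_row la (f b')) ->
  exists2 psi : 'S_n, psi \in col_perms n la &
    (f^-1 * psi)%g \in row_perms n la.
Proof.
move=> f_snake; have lt_f := snaking_row_lt_height f_snake.
pose g b := odflt b [pick b' : 'I_n | (box_row la b' == box_row la (f b))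
                                      && (box_col la b' == box_col la b)].
have gP b :
    box_row la (g b) = box_row la (f b) /\ box_col la (g b) = box_col la b.
  rewrite /g; case: pickP => [b' /andP[/eqP ? /eqP ?] // | no].
  have [b' [r_b' c_b']] := box_exists (lt_f b).
  by have:= no b'; rewrite r_b' c_b' !eqxx.
have g_inj : injective g.
  move=> b b' eq_g; apply/eqP/negPn/negP => neq_bb'.
  have [r_b c_b] := gP b; have [r_b' c_b'] := gP b'.
  by apply: (f_snake _ _ neq_bb'); rewrite -?r_b -?c_b -?r_b' -?c_b' eq_g.
exists (perm g_inj).
  by apply/col_permsP => b; rewrite permE; case: (gP b).
apply/row_permsP => b; rewrite permM permE.
by case: (gP ((f^-1)%g b)) => ->; rewrite permKV.
Qed.

Lemma returns_columnsP (T P s : 'S_n) :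
  returns_columns la T P s <->
  s \in row_perms n la /\ (T * P^-1 * s)%g \in col_perms n la.
Proof.
have act_imset c : box_act s P @: col_boxes n la c
    = [set (s^-1 * P)%g b | b in col_boxes n la c].
  by apply: eq_imset => b; rewrite permM.
split=> [[s_r s_c]|[s_r /col_permsP s_c]]; split=> //.
  apply/col_permsP => b; have: T b \in T @: col_boxes n la (box_col la b).
    by rewrite imset_f // inE.
  rewrite -s_c => /imsetP[b']; rewrite inE /box_act => /eqP <- def_b.
  by rewrite !permM def_b permK permKV.
have im_col (t : 'S_n) c x :
    (x \in [set t b | b in col_boxes n la c]) = (box_col la ((t^-1)%g x) == c).
  by rewrite -{1}[x](permKV t) mem_imset ?inE //; apply: perm_inj.
move=> c; rewrite act_imset; apply/setP => i.
by rewrite !im_col -[in RHS]s_c !permM permKV invMg invgK permM.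
Qed.

(** Uniqueness holds because only the identity preserves both rows and columns. *)
Lemma snaking_returns (T P : 'S_n) : is_snaking la T P ->
  exists s : 'S_n, unique (returns_columns la T P) s.
Proof.
move=> TP_snake.
have f_snake (b b' : 'I_n) : b != b' -> box_col la b = box_col la b' ->
    box_row la ((T * P^-1)%g b) <> box_row la ((T * P^-1)%g b').
  move=> neq_bb' eq_c; rewrite !permM; apply: TP_snake; last by rewrite !permK.
  by rewrite (inj_eq perm_inj).
have [psi psi_c psi_r] := snaking_factor f_snake.
exists ((T * P^-1)^-1 * psi)%g; split.
  by apply/returns_columnsP; split=> //; rewrite mulKVg.
move=> s /returns_columnsP[s_r s_c].
set pi := (_ * psi)%g in psi_r *; apply/eqP; rewrite eq_mulVg1; apply/eqP.
apply: row_col_perm; first by rewrite row_permsM ?row_permsV.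
have -> : (pi^-1 * s = psi^-1 * (T * P^-1 * s))%g.
  by rewrite /pi invMg invgK !mulgA.
by rewrite col_permsM ?col_permsV.
Qed.

(** * Coefficients of the Young symmetrizer *)

(** Two fillings with the same multiset of entries in every row differ by a row
    permutation. *)
Lemma perm_rows (Z Z' : 'I_n -> nat) :
  (forall r : 'I_n, perm_eq (row_entries la Z' r) (row_entries la Z r)) ->
  exists2 s : 'S_n, s \in row_perms n la & Z' =1 box_act s Z.
Proof.
move=> eq_rows.
have countE (Y : 'I_n -> nat) r v :
    count_mem (r, v) [tuple (box_row la i, Y i) | i < n]
      = count_mem v (row_entries la Y r).
  have -> : row_entries la Y r =
      [seq Y b | b <- enum 'I_n & b \in row_boxes n la r].
    by rewrite /row_entries enumT.
  rewrite /= !count_map count_filter.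
  rewrite enumT; apply: eq_count => b; rewrite /= inE xpair_eqE; exact: andbC.
(* Tagging entries with their rows glues the row-wise rearrangements. *)
have: perm_eq [tuple (box_row la i, Z' i) | i < n]
              [tuple (box_row la i, Z i) | i < n].
  apply/allP => -[r v]; rewrite mem_cat => rv_in; rewrite /= -/(is_true _).
  have lt_rn : (r < n)%N.
    by case/orP: rv_in => /mapP[b _ [-> _]]; apply: box_row_lt.
  rewrite !countE; apply/eqP.
  exact: (seq.permP (eq_rows (Ordinal lt_rn))).
case/tuple_permP => p /val_inj def_p.
have pP (i : 'I_n) : (box_row la i, Z' i) = (box_row la (p i), Z (p i)).
  have := congr1 (fun t => tnth t i) def_p.
  by rewrite !tnth_mktuple.
exists (p^-1)%g.
  by rewrite row_permsV; apply/row_permsP => i; case: (pP i).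
by move=> i; rewrite /box_act invgK; case: (pP i).
Qed.

Lemma row_entries_act (Z : 'I_n -> nat) (s : 'S_n) (r : nat) :
  s \in row_perms n la ->
  perm_eq (row_entries la (box_act s Z) r) (row_entries la Z r).
Proof.
move=> /row_permsP s_r.
rewrite /row_entries /box_act (map_comp Z (s^-1)%g) perm_map //.
apply: uniq_perm; rewrite ?map_inj_uniq ?enum_uniq //; first exact: perm_inj.
move=> b; rewrite -{1}[b](permK s) (mem_map (@perm_inj _ _)) !mem_enum !inE.
by rewrite s_r.
Qed.

(** The row permutations [s] with [s S = tau (pi S)] form a coset of [H S], or
    there are none. *)
Lemma card_row_perms_act (S : 'I_n -> nat) (pi tau : 'S_n) :
  pi \in row_perms n la -> tau \in col_perms n la ->
  #|[set s in row_perms n la |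
      [forall b, box_act tau (box_act pi S) b == box_act s S b]]|
  = (if tau \in A la (box_act pi S) then #|H la S| else 0)%N.
Proof.
move=> pi_r tau_c; rewrite /A inE tau_c /=.
case: ifP => [/forallP eq_rows | /negP no_rows].
  have [s s_r eq_s] := perm_rows eq_rows.
  have -> : [set s0 in row_perms n la |
      [forall b, box_act tau (box_act pi S) b == box_act s0 S b]]
      = (H la S :* (pi * s))%g.
    apply/setP => s0; rewrite mem_rcoset [LHS]inE [RHS]inE.
    have ps_r : (pi * s)%g \in row_perms n la by apply: row_permsM.
    have -> : ((s0 * (pi * s)^-1)%g \in row_perms n la) = (s0 \in row_perms n la).
      apply/idP/idP => [s0_r|s0_r]; last by rewrite row_permsM ?row_permsV.
      by rewrite -(mulgKV (pi * s)%g s0) row_permsM.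
    congr andb; apply/forallP/forallP => eqS b.
      have := eqS ((pi * s)%g b); rewrite eq_s /box_act.
      by rewrite !(invMg, invgK, permM, permK) eq_sym.
    have := eqS (((pi * s)^-1)%g b); rewrite eq_s /box_act.
    by rewrite !(invMg, invgK, permM, permKV) eq_sym.
  by rewrite card_rcoset.
apply: eq_card0 => s; rewrite inE; apply/negbTE/andP => -[s_r /forallP eqS].
case: no_rows; apply/forallP => r.
rewrite /row_entries (eq_map (fun b => eqP (eqS b))) -!/(row_entries _ _ _).
apply: perm_trans (row_entries_act S r s_r) _.
by rewrite perm_sym row_entries_act.
Qed.

Lemma preserving_conj (X : nat -> {set 'I_n}) (T s : 'S_n) :
  ((s ^ T)%g \in preserving (fun k => T @: X k)) = (s \in preserving X).
Proof.
rewrite !inE; apply: eq_forallb => k.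
have -> : (s ^ T)%g @: (T @: X k) = T @: (s @: X k).
  by rewrite -!imset_comp; apply: eq_imset => b /=; rewrite permJ.
by rewrite (inj_eq (imset_inj (@perm_inj _ T))).
Qed.

Lemma xmonE (Q : 'S_n) (S : 'I_n -> nat) (i : 'I_n) :
  xmon Q S i = S ((Q^-1)%g i).
Proof.
rewrite /xmon mnm_sumE (bigD1 ((Q^-1)%g i)) //= mulmnE mnm1E permKV eqxx mul1n.
rewrite big1 ?addn0 // => b neq_b; rewrite mulmnE mnm1E.
by case: eqP => // def_i; rewrite -def_i permK eqxx in neq_b.
Qed.

Lemma msym_xmon (K : comNzRingType) (Q s : 'S_n) (S : 'I_n -> nat) :
  msym s 'X_[xmon Q S] = 'X_[xmon (Q * s) S] :> {mpoly K[n]}.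
Proof.
rewrite msymX; congr 'X_[_]; apply/mnmP => i.
by rewrite mnmE !xmonE invMg permM.
Qed.

(** The sums over the row and column groups of [T], moved to box permutations
    through [T]. *)
Lemma young_sym_xmon (K : comNzRingType) (T : 'S_n) (S : 'I_n -> nat) :
  F la K T S = \sum_(tau in col_perms n la) \sum_(s in row_perms n la)
    (-1) ^+ tau *: 'X_[xmon (s * tau * T) S].
Proof.
rewrite /F /young_sym (reindex_inj (conjg_inj T)) /=.
apply: eq_big => [tau|tau _]; first exact: preserving_conj.
rewrite (reindex_inj (conjg_inj T)) /=.
apply: eq_big => [s|s _]; first exact: preserving_conj.
by rewrite odd_permJ !msym_xmon !conjgE !mulgA mulgV mul1g mulgK.
Qed.

Lemma coef_young_sym (K : comNzRingType) (S : 'I_n -> nat) (T P pi : 'S_n) :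
  returns_columns la T P pi ->
  (F la K T S)@_(xmon P S) =
    (-1) ^+ (T * P^-1 * pi)%g * (#|H la S|%:R *
      \sum_(tau in A la (box_act pi S)) (-1) ^+ tau).
Proof.
move=> /returns_columnsP[pi_r]; set psi := (T * P^-1 * pi)%g => psi_c.
rewrite young_sym_xmon raddf_sum /=.
(* The term of F at tau^-1 * psi^-1 gives the term at tau of the sum over A. *)
rewrite (reindex_inj (inj_comp (mulIg psi^-1%g) invg_inj)) /=.
rewrite [in RHS]big_mkcond mulr_sumr mulr_sumr [LHS]big_mkcond /=.
apply: eq_bigr => tau _.
have -> : ((tau^-1 * psi^-1)%g \in col_perms n la) = (tau \in col_perms n la).
  rewrite -invMg col_permsV; apply/idP/idP => [c|c]; last exact: col_permsM.
  by rewrite -(mulKg psi tau) col_permsM ?col_permsV.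
case: ifPn => [tau_c|tau_c]; last first.
  by rewrite ifN ?mulr0 // inE negb_and tau_c.
have sgn : (-1) ^+ (tau^-1 * psi^-1)%g = (-1) ^+ psi * (-1) ^+ tau :> K.
  by rewrite odd_permM !odd_permV signr_addb mulrC.
rewrite raddf_sum /= sgn.
transitivity ((-1) ^+ psi * (-1) ^+ tau *
    #|[set s in row_perms n la |
       [forall b, box_act tau (box_act pi S) b == box_act s S b]]|%:R : K).
  rewrite -sum1_card natr_sum mulr_sumr [LHS]big_mkcond [RHS]big_mkcond /=.
  apply: eq_bigr => s _; rewrite [in RHS]inE; case: ifP => //= _.
  rewrite mcoeffZ mcoeffX.
  have -> : (xmon (s * (tau^-1 * psi^-1) * T) S == xmon P S)
      = [forall b, box_act tau (box_act pi S) b == box_act s S b].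
    apply/eqP/forallP => [/mnmP eqm b|eqS]; last first.
      apply/mnmP => i; rewrite !xmonE.
      have := eqP (eqS ((tau (psi ((T^-1)%g i))))).
      rewrite /box_act permK /psi !permM permK permKV => ->.
      by rewrite !(invMg, permM, invgK) permKV.
    have := eqm (T ((psi^-1)%g ((tau^-1)%g b))); rewrite !xmonE /box_act.
    by rewrite !(invMg, invgK, permM, permK, permKV) => ->.
  by case: forallP; rewrite ?mulr1 ?mulr0.
rewrite card_row_perms_act //; case: ifP => _; last by rewrite !mulr0.
by rewrite -mulrA [_ * _%:R]mulrC.
Qed.

End Partition.

Theorem theorem1p12 (R : realType) (n : nat) (la : seq nat)
    (S : 'I_n -> nat) (T P : 'S_n) :
  is_partition n la -> is_SYT la T -> is_snaking la T P ->
  exists pi : 'S_n, unique (returns_columns la T P) pi /\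
  exists e : bool,
    (F la R[i] T S)@_(xmon P S) =
      (-1) ^+ e * (#|H la S|%:R *
        \sum_(tau in A la (box_act pi S)) (-1) ^+ tau).
Proof.
move=> la_part _ TP_snake.
have [pi pi_unique] := snaking_returns la_part TP_snake.
exists pi; split=> //; exists (odd_perm (T * P^-1 * pi)%g).
by apply: coef_young_sym => //; case: pi_unique.
Qed.
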